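(* Let $\mathbb K$ be a field of characteristic zero and let $\rho_{\mathbb K}^*:\mathcal H_{\rm FdB}^{cop}(\mathbb K)\rightarrow\mathbb K\langle\mathscr A\rangle$ be the monomorphism of graded Hopf algebras obtained as the transpose of the surjective morphism $\rho_{\mathbb K}:\mathbb K\langle\mathbf X\rangle\rightarrow\mathcal H_{\rm FdB}^{cop}(\mathbb K)^*$ determined by $\rho_{\mathbb K}(X_i)=t_i'$, $i\in\mathbb N$. Then the values of $\rho_{\mathbb K}^*$ on the generators $t_i$ are the displacement polynomials, i.e. $$\rho_{\mathbb K}^*(t_i)=\mathcal P_i(\alpha_1,\dots,\alpha_i)=\sum_{i_1+\cdots+i_k=i}p_{i_1,\dots,i_k}(i)\,\alpha_{i_k}\cdots\alpha_{i_1},\qquad i\in\mathbb N,$$ where the product of letters in $\mathcal P_i(\alpha_1,\dots,\alpha_i)$ is concatenation of words.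
   Context: Displacement polynomials: for free noncommutative variables $X_1,X_2,\dots$ and $i\in\mathbb N$, $\mathcal P_i(X_1,\dots,X_i)=\sum_{i_1+\cdots+i_k=i}p_{i_1,\dots,i_k}(i)\,X_{i_k}\cdots X_{i_1}$, where the sum runs over all $k\in\{1,\dots,i\}$ and all $(i_1,\dots,i_k)\in\mathbb N^k$ with sum $i$, and $p_{i_1,\dots,i_k}(t)=(t-i_1+1)(t-i_1-i_2+1)\cdots(t-i_1-\cdots-i_k+1)$. Shuffle Hopf algebra: $\mathscr A=\{\alpha_i:i\in\mathbb N\}$ is a countable alphabet, $\mathscr A^*$ is the set of words including the empty word $1$, and $\mathbb K\langle\mathscr A\rangle$ is the vector space with basis $\mathscr A^*$. Its product is the (commutative) shuffle product, its coproduct is decatenation $\Delta(\alpha_{i_1}\cdots\alpha_{i_p})=\sum_{j=0}^{p}\alpha_{i_1}\cdots\alpha_{i_j}\otimes\alpha_{i_{j+1}}\cdots\alpha_{i_p}$, and its grading is given by $\deg(\alpha_{i_1}\cdots\alpha_{i_p})=i_1+\cdots+i_p$. Its graded dual is $\mathbb K\langle\mathbf X\rangle$, the free associative unital algebra (unit $I$) on $\mathbf X=\{X_i:i\in\mathbb N\}$, $\deg X_i=i$, with $\Delta(X_i)=I\otimes X_i+X_i\otimes I$; the duality makes the monomial basis $X_{i_1}\cdots X_{i_p}$ dual to the basis of words $\alpha_{i_1}\cdots\alpha_{i_p}$. Co-opposite Faà di Bruno Hopf algebra: $\mathcal H_{\rm FdB}^{cop}(\mathbb K)=\mathbb K[t_1,t_2,\dots]$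 (commutative polynomials, $\deg t_i=i$, $t_0:=1$), with coproduct the algebra morphism given by $$\Delta_{\rm FdB}^{op}(t_i)=\sum_{j=0}^i t_j\otimes\Bigl(\sum\frac{(j+1)!}{l_0!\,l_1!\cdots l_i!}\,t_1^{l_1}\cdots t_i^{l_i}\Bigr),$$ the inner sum being over nonnegative integers $l_0,\dots,l_i$ with $l_0+\cdots+l_i=j+1$ and $l_1+2l_2+\cdots+il_i=i-j$, and counit the algebra morphism with $\varepsilon(t_i)=0$ for $i\ge1$. Its graded dual $\mathcal H_{\rm FdB}^{cop}(\mathbb K)^*$ is an algebra under convolution $\alpha*\beta=m_{\mathbb K}\circ(\alpha\otimes\beta)\circ\Delta_{\rm FdB}^{op}$, with unit $\varepsilon$. The elements $t_i'\in\mathcal H_{\rm FdB}^{cop}(\mathbb K)^*$, $i\in\mathbb N$, are defined by $t_i'(1)=0$, $t_i'(t_j)=\delta_{ij}$ and $t_i'(t_{i_1}\cdots t_{i_k})=0$ for $k\ge2$; they form a basis of the Lie algebra of primitive elements and satisfy $t_i'*t_j'-t_j'*t_i'=(i-j)t_{i+j}'$. The map $\rho_{\mathbb K}$ is the unital algebra (in fact graded Hopf algebra) morphism with $\rho_{\mathbb K}(X_i)=t_i'$; its transpose $\rho_{\mathbb K}^*$ is defined by $\langle w,\rho_{\mathbb K}^*(h)\rangle=\rho_{\mathbb K}(w)(h)$ for $w\in\mathbb K\langle\mathbf X\rangle$, $h\in\mathcal H_{\rm FdB}^{cop}(\mathbb K)$. *)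

(* Defs.v *)
From HB Require Import structures.
From mathcomp Require Import all_boot all_order all_algebra finmap.
From mathcomp.multinomials Require Import monalg.

Set Implicit Arguments.
Unset Strict Implicit.
Unset Printing Implicit Defensive.

Import GRing.Theory.
Local Open Scope ring_scope.

(* Pairs of monomials form a monomial monoid; the algebra on it is the tensor *)
(* product of the two monomial algebras, with (m, n) standing for m (x) n.    *)
Section PairMonomials.
Variables M N : conomType.
Let pone : M * N := (@mone M, @mone N).
Let pmul (x y : M * N) : M * N := (mmul x.1 y.1, mmul x.2 y.2).

Fact pair_mulA : associative pmul.
Proof. by move=> x y z; rewrite /pmul /= !mulmA. Qed.
Fact pair_mul1m : left_id pone pmul.
Proof. by case=> x y; rewrite /pmul /= !mul1m. Qed.
Fact pair_mulm1 : right_id pone pmul.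
Proof. by case=> x y; rewrite /pmul /= !mulm1. Qed.
Fact pair_unitm x y : pmul x y = pone -> x = pone /\ y = pone.
Proof. by case: x y => [x x'] [y y'] [] /unitm[-> ->] /unitm[-> ->]. Qed.
Fact pair_mulC : commutative pmul.
Proof. by case=> x y [x' y']; rewrite /pmul /= (mulmC x) (mulmC y). Qed.

HB.instance Definition _ := Choice_isMonomialDef.Build (M * N)%type
  pair_mulA pair_mul1m pair_mulm1 pair_unitm.
HB.instance Definition _ :=
  MonomialDef_isConomialDef.Build (M * N)%type pair_mulC.
End PairMonomials.

(* Variables are indexed by {1, 2, ...}: the variable k : nat of the monomial   *)
(* monoids below stands for t_(k+1), resp. X_(k+1), resp. alpha_(k+1).        *)
Notation fdb K := {malg K[{cmonom nat}]}.
Notation fdb2 K := {malg K[({cmonom nat} * {cmonom nat})%type]}.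
Notation freeAlg K := {malg K[{fmonom nat}]}.

(* K<A> is the same vector space with basis the words; only its concatenation *)
(* product, i.e. the ring product of {malg K[{fmonom nat}]}, is used.         *)
Notation words K := {malg K[{fmonom nat}]}.

Section Displacement.
Variable K : fieldType.

Definition p_coef (c : seq nat) (t : K) : K :=
  \prod_(1 <= j < (size c).+1) (t - (\sum_(a <- take j c) a)%N%:R + 1).

Definition is_composition (i : nat) (c : seq nat) : bool :=
  all (fun a => 0 < a)%N c && (\sum_(a <- c) a == i)%N.

(* P_i evaluated at elements x 1, ..., x i of an algebra.  The parts of a     *)
(* composition of i are at most i, so tuples over 'I_i.+1 give all of them.   *)
Definition displacement (A : lalgType K) (x : nat -> A) (i : nat) : A :=
  \sum_(1 <= k < i.+1)
    \sum_(c : k.-tuple 'I_i.+1 | is_composition i (map val c))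
      p_coef (map val c) i%:R *: \prod_(a <- rev (map val c)) x a.
End Displacement.

Section FaaDiBruno.
Variable K : fieldType.

Definition tgen (i : nat) : fdb K := if i is j.+1 then << ucm j >> else 1.

Definition mon_deg (m : {cmonom nat}) : nat :=
  (\sum_(k <- finsupp m) k.+1 * m k)%N.

Definition tensor (u v : fdb K) : fdb2 K :=
  \sum_(m <- msupp u) \sum_(n <- msupp v) << u@_m * v@_n *g (m, n) >>.

(* Indices l_0, ..., l_i with sum j+1 are at most j+1, whence the ffun type.  *)
Definition fdb_right (i j : nat) : fdb K :=
  \sum_(l : {ffun 'I_i.+1 -> 'I_j.+2}
        | ((\sum_(k < i.+1) l k)%N == j.+1) && ((\sum_(k < i.+1) k * l k)%N == (i - j)%N))
     (((j.+1)`!)%:R / (\prod_(k < i.+1) (l k)`!)%:R) *: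
       \prod_(k < i.+1 | (0 < k)%N) tgen k ^+ l k.

Definition Delta_gen (i : nat) : fdb2 K :=
  \sum_(j < i.+1) tensor (tgen j) (fdb_right i j).

(* The algebra morphism with t_i |-> Delta_gen i (see Delta_alg_morphism).    *)
Definition Delta (h : fdb K) : fdb2 K :=
  \sum_(m <- msupp h)
     h@_m *: \prod_(k <- finsupp m) Delta_gen k.+1 ^+ m k.

Definition counit (h : fdb K) : K := h@_(@mone {cmonom nat}).

Definition functional := fdb K -> K.

Definition in_graded_dual (f : functional) : Prop :=
  (forall c g h, f (c *: g + h) = c * f g + f h) /\
  (exists n, forall m, (n < mon_deg m)%N -> f << m >> = 0).

Definition tensor_fun (f g : functional) (z : fdb2 K) : K :=
  \sum_(mn <- msupp z) z@_mn * (f << mn.1 >> * g << mn.2 >>).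

Definition conv (f g : functional) : functional :=
  fun h => tensor_fun f g (Delta h).

Definition t' (i : nat) : functional := fun h => h@_(ucm i.-1).

Definition Xgen (i : nat) : freeAlg K := << fmu i.-1 >>.
Definition alpha (i : nat) : words K := << fmu i.-1 >>.

(* These conditions determine rho, and some rho satisfies them: see           *)
(* rho_unique and rho_exists.  Its transpose also exists: transpose_exists.   *)
Record is_rho (rho : freeAlg K -> functional) : Prop := IsRho {
  rho_dual : forall w, in_graded_dual (rho w);
  rho_linear : forall c u v, rho (c *: u + v) =1 (fun h => c * rho u h + rho v h);
  rho_one : rho 1 =1 counit;
  rho_mul : forall u v, rho (u * v) =1 conv (rho u) (rho v);
  rho_gen : forall i, (0 < i)%N -> rho (Xgen i) =1 t' i
}.

(* Words form the basis dual to the monomials of K<X>.                        *)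
Definition pairing (w : freeAlg K) (x : words K) : K :=
  \sum_(s <- msupp w) w@_s * x@_s.

Definition is_transpose (rho : freeAlg K -> functional) (rhoT : fdb K -> words K)
  : Prop := forall w h, pairing w (rhoT h) = rho w h.

End FaaDiBruno.

Section Multinomial.
Variables (K : fieldType) (B : comNzRingType) (f : {rmorphism K -> B}).
Hypothesis charK : [pchar K] =i pred0.

Let dpow (x : B) n := f (n`!%:R)^-1 * x ^+ n.

Lemma natf_neq0_char n : (n.+1%:R : K) != 0.
Proof. by rewrite ((pcharf0P K).1 charK). Qed.

Lemma fact_neq0_char n : (n`!%:R : K) != 0.
Proof. by rewrite -(prednK (fact_gt0 n)) natf_neq0_char. Qed.

Lemma dpowD x y n :
  dpow (x + y) n = \sum_(a < n.+1) dpow x (n - a) * dpow y a.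
Proof.
rewrite /dpow exprDn mulr_sumr; apply: eq_bigr => a _.
have an : (a <= n)%N by rewrite -ltnS.
rewrite mulrACA -rmorphM mulrnAr -mulrnAl -rmorphMn /=; congr (f _ * _).
rewrite -mulr_natr; apply: (mulfI (fact_neq0_char n)).
rewrite mulrA mulfV ?mul1r ?fact_neq0_char //.
rewrite -(bin_fact an) !natrM -invfM [X in X^-1]mulrC mulfK //.
by rewrite mulf_neq0 ?fact_neq0_char.
Qed.

Lemma multinomial m (x : 'I_m -> B) n :
  dpow (\sum_(k < m) x k) n =
  \sum_(l : {ffun 'I_m -> 'I_n.+1} | (\sum_(k < m) l k)%N == n)
    \prod_(k < m) dpow (x k) (l k).
Proof.
pose E y := \poly_(a < n.+1) dpow y a.
pose P (p : {poly B}) y := forall a, (a <= n)%N -> p`_a = dpow y a.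
have EP : P (\prod_(k < m) E (x k)) (\sum_(k < m) x k).
  apply: (big_ind2 P) => [a an|p u q v hp hq a an|k _ a an].
  - rewrite coef1 /dpow expr0n; case: a {an} => [|a] /=; last by rewrite mulr0.
    by rewrite fact0 invr1 mulr1; apply/esym; exact: rmorph1.
  - rewrite addrC dpowD coefM; apply: eq_bigr => -[b /= ba] _.
    rewrite hp ?hq ?(leq_trans _ an) ?leq_subr //; first by rewrite mulrC.
  - by rewrite coef_poly ltnS an.
rewrite -(EP n) // /E; under eq_bigr do rewrite poly_def.
rewrite bigA_distr_bigA /= coef_sum [RHS]big_mkcond /=; apply: eq_bigr => l _.
rewrite scaler_prod prodrXr coefZ coefXn eq_sym.
by case: eqP => _; rewrite ?mulr1 ?mulr0.
Qed.
End Multinomial.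

Section Series.
Variable R : comNzRingType.
Implicit Types (p q : {poly R}) (g h k : nat -> R).

Definition eqm n p q := exists r, p = q + 'X^n * r.

Lemma eqm_coef n p q i : eqm n p q -> (i < n)%N -> p`_i = q`_i.
Proof. by case=> r -> lin; rewrite coefD coefXnM lin addr0. Qed.

Lemma coef_eqm n p q : (forall i, (i < n)%N -> p`_i = q`_i) -> eqm n p q.
Proof.
move=> h; exists (drop_poly n (p - q)).
have h0 : take_poly n (p - q) = 0.
  apply/polyP=> i; rewrite coef_take_poly coefB coef0.
  by case: ifP => // /h->; rewrite subrr.
have := poly_take_drop n (p - q).
by rewrite h0 add0r mulrC => ->; rewrite addrC subrK.
Qed.

Lemma eqmX n p q i : eqm n p q -> eqm n (p ^+ i) (q ^+ i).
Proof.
move=> [r ->]; elim: i => [|i [s IH]]; first by exists 0; rewrite mulr0 addr0.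
exists (r * q ^+ i + q * s + r * ('X^n * s)).
rewrite !exprS IH mulrDl !mulrDr !mulrA [q * 'X^n]mulrC.
by rewrite !addrA; congr (_ + _); rewrite addrAC.
Qed.

Definition ser n g : {poly R} := \sum_(j < n.+1) g j *: 'X^(j.+1).
Definition star g h i := \sum_(j < i.+1) g j * ((ser i h) ^+ j.+1)`_i.+1.

Lemma coef_ser n g i : (i <= n)%N -> (ser n g)`_i.+1 = g i.
Proof.
move=> lin; rewrite coef_sum (bigD1 (Ordinal (lin : i < n.+1)%N)) //=.
rewrite coefZ coefXn eqxx mulr1 big1 ?addr0 // => j nj.
rewrite coefZ coefXn eqSS; case: eqP => [e|_]; last by rewrite mulr0.
by case/eqP: nj; apply: val_inj.
Qed.

Lemma coef_ser0 n g : (ser n g)`_0 = 0.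
Proof. by rewrite coef_sum big1 // => j _; rewrite coefZ coefXn mulr0. Qed.

Lemma serX n g : ser n g = 'X * \sum_(j < n.+1) g j *: 'X^j.
Proof. by rewrite mulr_sumr; apply: eq_bigr => j _; rewrite -scalerAr exprS. Qed.

Lemma ser_comp n g q : ser n g \Po q = \sum_(j < n.+1) g j *: q ^+ j.+1.
Proof.
rewrite /ser raddf_sum /=; apply: eq_bigr => j _.
by rewrite comp_polyZ comp_Xn_poly.
Qed.

Lemma ser_star n g h : eqm n.+2 (ser n (star g h)) (ser n g \Po ser n h).
Proof.
apply: coef_eqm => -[|i] lin.
  rewrite coef_ser0 ser_comp coef_sum big1 // => j _.
  by rewrite coefZ serX exprMn exprS -!mulrA coefXM mulr0.
rewrite ltnS in lin; rewrite coef_ser // ser_comp coef_sum /star.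
rewrite (big_ord_widen n.+1 (fun j => g j * ((ser i h) ^+ j.+1)`_i.+1)) //.
rewrite big_mkcond; apply: eq_bigr => j _ /=; rewrite coefZ ltnS; case: leqP => ij.
  congr (_ * _); apply: (@eqm_coef i.+2) => //; apply: eqmX; apply: coef_eqm.
  case=> [|k] lk; rewrite ?coef_ser0 // !coef_ser //.
  exact: leq_trans (lk : (k <= i)%N) lin.
by rewrite serX exprMn coefXnM ltnS ij mulr0.
Qed.

Lemma starA g h k i : star (star g h) k i = star g (star h k) i.
Proof.
have sE u v : star u v i = (ser i u \Po ser i v)`_i.+1.
  by rewrite -(eqm_coef (ser_star i u v)) // coef_ser.
rewrite !sE.
have [r1 e1] := ser_star i g h; have [r2 e2] := ser_star i h k.
rewrite e1 comp_polyD comp_polyM comp_Xn_poly coefD [X in _ + X](_ : _ = 0) ?addr0; last first.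
  by rewrite serX exprMn -mulrA coefXnM ltnSn.
rewrite -comp_polyA; apply/esym; apply: (@eqm_coef i.+2) => //.
have := ser_star i h k; set a := ser i _; set b := _ \Po _ => ab.
rewrite !ser_comp.
apply: coef_eqm => l ll; rewrite !coef_sum; apply: eq_bigr => j _.
by rewrite !coefZ; congr (_ * _); apply: (@eqm_coef i.+2) => //; apply: eqmX.
Qed.

Definition gen0 (i : nat) : R := (i == 0%N)%:R.

Lemma star0g g i : star gen0 g i = g i.
Proof.
rewrite /star big_ord_recl /= mul1r coef_ser // big1 ?addr0 // => j _.
by rewrite /gen0 mul0r.
Qed.

Lemma starg0 g i : star g gen0 i = g i.
Proof.
rewrite /star; have -> : ser i gen0 = 'X.
  rewrite /ser big_ord_recl /= /gen0 scale1r big1 ?addr0 ?expr1 // => j _.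
  by rewrite scale0r.
rewrite big_ord_recr /= coefXn eqxx mulr1 big1 ?add0r // => j _.
by rewrite coefXn eqSS eq_sym ltn_eqF ?mulr0.
Qed.
End Series.

Section LinearExtension.
Variables (K : fieldType) (M : choiceType) (S : lmodType K).
Implicit Types (F : M -> S) (z : {malg K[M]}).

Definition lext F z : S := \sum_(m <- msupp z) z@_m *: F m.

Lemma lextEw F (d : {fset M}) z : (msupp z `<=` d)%fset ->
  lext F z = \sum_(m <- d) z@_m *: F m.
Proof.
move=> le; rewrite /lext (big_fset_incl _ le) // => m _ /mcoeff_outdom ->.
by rewrite scale0r.
Qed.

Fact lext_is_linear F : linear (lext F).
Proof.
move=> c u v; have le1 := fsubsetUl (msupp u) (msupp v).
have le2 := fsubsetUr (msupp u) (msupp v).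
rewrite (lextEw F le1) (lextEw F le2).
have le : (msupp (c *: u + v) `<=` msupp u `|` msupp v)%fset.
  apply: fsubset_trans (msuppD_le _ _) _.
  by apply: fsetSU; exact: msuppZ_le.
rewrite (lextEw F le) scaler_sumr -big_split /=; apply: eq_bigr => m _.
by rewrite mcoeffD mcoeffZ scalerDl scalerA.
Qed.
HB.instance Definition _ F :=
  GRing.isLinear.Build K {malg K[M]} S _ (lext F) (lext_is_linear F).

Lemma lextU F c m : lext F << c *g m >> = c *: F m.
Proof.
rewrite (lextEw F (msuppU_le (k := m))) big_seq_fset1.
by rewrite mcoeffUU.
Qed.

Lemma eq_lext F F' : F =1 F' -> lext F =1 lext F'.
Proof. by move=> e z; apply: eq_bigr => m _; rewrite e. Qed.

End LinearExtension.

Lemma lext_lin (K : fieldType) (M : choiceType) (S S' : lmodType K)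
  (F : M -> S) (z : {malg K[M]}) (f : {linear S -> S'}) :
  f (lext F z) = lext (f \o F) z.
Proof. by rewrite linear_sum; apply: eq_bigr => m _; rewrite linearZ. Qed.

Lemma lext_id (K : fieldType) (M : choiceType) (z : {malg K[M]}) :
  lext (fun m => << m >>) z = z.
Proof.
rewrite [RHS]monalgE; apply: eq_bigr => m _.
by apply/malgP => k; rewrite mcoeffZ !mcoeffU mulr_natr.
Qed.

Lemma linfun_lext (K : fieldType) (M : choiceType) (f : {malg K[M]} -> K) :
  (forall c g h, f (c *: g + h) = c * f g + f h) ->
  forall z, f z = lext (fun m => f << m >> : K^o) z.
Proof.
move=> lf z.
have f0 : f 0 = 0.
  by have := lf (-1) 0 0; rewrite scaler0 addr0 mulN1r addNr.
rewrite -{1}(lext_id z) /lext; elim/big_rec2: _ => // m y1 y2 _ <-.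
by rewrite lf.
Qed.

Lemma lext_mult (K : fieldType) (M : conomType) (S : comAlgType K) (F : M -> S) :
  F (@mone M) = 1 -> (forall m n, F (mmul m n) = F m * F n) ->
  (lext F 1 = 1) * (forall u v, lext F (u * v) = lext F u * lext F v).
Proof.
move=> F1 FM; split.
  by rewrite -[1]/(<< @mone M >> : {malg K[M]}) lextU scale1r.
move=> u v.
rewrite {1}(monalgE u) {1}(monalgE v) [lext F u]/lext [lext F v]/lext.
rewrite !mulr_suml linear_sum; apply: eq_bigr => m _.
rewrite !mulr_sumr linear_sum; apply: eq_bigr => n _ /=.
by rewrite malgM_def fgmulUU lextU FM -scalerAl -scalerAr scalerA.
Qed.

Section Eval.
Variable K : fieldType.
Notation C := {cmonom nat}.

Lemma cmonom_ind (P : C -> Prop) :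
  P (@mone C) -> (forall k m, P m -> P (mmul (ucm k) m)) -> forall m, P m.
Proof.
move=> P1 PS m; have [n] := ubnP (mdeg m); elim: n m => // n IH m lmn.
have [/eqP e|] := boolP (mdeg m == 0%N); first by rewrite (mdeg_eq0I e).
rewrite mdeg_eq0 => m1.
have [k mk] : exists k, m k != 0%N.
  have [/fset0Pn [k]|/negPn/eqP e] := boolP (finsupp m != fset0)%fset.
    by rewrite mem_finsupp => mk; exists k.
  by case/eqP: m1; apply/eqP/cmP => i; rewrite cm1; apply: fsfun_dflt; rewrite e inE.
have e : m = mmul (ucm k) (divcm m (ucm k)).
  apply/eqP/cmP => i; rewrite cmM divcmE cmU; case: eqP => [<-|_]; last by rewrite subn0.
  by rewrite subnKC // lt0n.
rewrite e; apply: PS; apply: IH; move: lmn; rewrite {1}e mdegM mdegU add1n.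
by rewrite ltnS.
Qed.

Variable S : comAlgType K.
Implicit Types g : nat -> S.

Definition evm g (m : C) : S := \prod_(k <- finsupp m) g k.+1 ^+ m k.
Definition ev g : fdb K -> S := lext (evm g).

Lemma evmEw g (m : C) (d : {fset nat}) : (finsupp m `<=` d)%fset ->
  evm g m = \prod_(k <- d) g k.+1 ^+ m k.
Proof.
move=> le; rewrite /evm (big_fset_incl _ le) // => k _ nk.
by rewrite (fsfun_dflt nk) expr0.
Qed.

Lemma evm1 g : evm g (@mone C) = 1.
Proof. by rewrite /evm mdom1 big_seq_fset0. Qed.

Lemma evmU g k : evm g (ucm k) = g k.+1.
Proof. by rewrite /evm mdomU big_seq_fset1 cmUU expr1. Qed.

Lemma evmM g m n : evm g (mmul m n) = evm g m * evm g n.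
Proof.
rewrite {1}/evm mdomD (evmEw g (fsubsetUl (finsupp m) (finsupp n))).
rewrite (evmEw g (fsubsetUr (finsupp m) (finsupp n))) -big_split /=.
by apply: eq_bigr => k _; rewrite cmM exprD.
Qed.

Lemma evm_unique g (F : C -> S) : F (@mone C) = 1 ->
  (forall m n, F (mmul m n) = F m * F n) -> (forall k, F (ucm k) = g k.+1) ->
  F =1 evm g.
Proof.
move=> F1 FM FU; elim/cmonom_ind => [|k m IH]; first by rewrite F1 evm1.
by rewrite FM evmM evmU FU IH.
Qed.

Lemma eq_evm g g' : (forall k, g k.+1 = g' k.+1) -> evm g =1 evm g'.
Proof. by move=> e m; apply: eq_bigr => k _; rewrite e. Qed.

Lemma ev1 g : ev g 1 = 1. Proof. exact: (lext_mult (evm1 g) (evmM g)).1. Qed.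
Lemma evM g u v : ev g (u * v) = ev g u * ev g v.
Proof. exact: (lext_mult (evm1 g) (evmM g)).2. Qed.
Lemma evX g u n : ev g (u ^+ n) = ev g u ^+ n.
Proof. by elim: n => [|n IH]; rewrite ?expr0 ?ev1 // !exprS evM IH. Qed.
Lemma ev_tgen g k : g 0%N = 1 -> ev g (tgen K k) = g k.
Proof.
case: k => [|k] g0; first by rewrite ev1 g0.
by rewrite /= /ev lextU scale1r evmU.
Qed.

Definition ev2 (g1 g2 : nat -> S) : fdb2 K -> S :=
  lext (fun mn : C * C => evm g1 mn.1 * evm g2 mn.2).

Let P1 g1 g2 : evm g1 (@mone C) * evm g2 (@mone C) = 1.
Proof. by rewrite !evm1 mulr1. Qed.
Let PM g1 g2 (x y : C * C) : evm g1 (mmul x y).1 * evm g2 (mmul x y).2 =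
  (evm g1 x.1 * evm g2 x.2) * (evm g1 y.1 * evm g2 y.2).
Proof. by rewrite !evmM mulrACA. Qed.

Lemma ev2_1 g1 g2 : ev2 g1 g2 1 = 1.
Proof. exact: (lext_mult (M := (C * C)%type) (P1 g1 g2) (PM g1 g2)).1. Qed.
Lemma ev2M g1 g2 u v : ev2 g1 g2 (u * v) = ev2 g1 g2 u * ev2 g1 g2 v.
Proof. exact: (lext_mult (M := (C * C)%type) (P1 g1 g2) (PM g1 g2)).2. Qed.
Lemma ev2X g1 g2 u n : ev2 g1 g2 (u ^+ n) = ev2 g1 g2 u ^+ n.
Proof. by elim: n => [|n IH]; rewrite ?expr0 ?ev2_1 // !exprS ev2M IH. Qed.

Lemma ev2_tensor g1 g2 u v : ev2 g1 g2 (tensor u v) = ev g1 u * ev g2 v.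
Proof.
rewrite /tensor /ev2 linear_sum mulr_suml; apply: eq_bigr => m _.
rewrite linear_sum mulr_sumr; apply: eq_bigr => n _.
by rewrite /= lextU -scalerAl -scalerAr scalerA.
Qed.

Hypothesis charK : [pchar K] =i pred0.


Lemma ev_fdb_right g i j : g 0%N = 1 -> (j <= i)%N ->
  ev g (fdb_right K i j) = ((ser i g) ^+ j.+1)`_i.+1.
Proof.
move=> g0 ji; rewrite serX exprMn coefXnM ltnS ltnNge ji /= subSS.
set Y := \sum_(_ < _) _.
have f0 n := fact_neq0_char charK n.
have [f fE] : exists f : {rmorphism K -> {poly S}}, forall c, f c = (c *: 1)%:P.
  by exists (polyC \o in_alg S).
have YE : (Y ^+ j.+1)`_(i - j) =
    (j.+1)`!%:R *: (f (j.+1)`!%:R^-1 * Y ^+ j.+1)`_(i - j).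
  by rewrite fE coefCM -scalerAl mul1r scalerA mulfV // scale1r.
rewrite YE (multinomial f charK) coef_sum scaler_sumr /ev linear_sum /=.
rewrite big_mkcondr /=; apply: eq_bigr => l lj.
have -> : \prod_(k < i.+1) (f (l k)`!%:R^-1 * (g k *: 'X^k) ^+ l k) =
   f ((\prod_(k < i.+1) (l k)`!)%:R^-1) *
     ((\prod_(k < i.+1) g k ^+ l k) *: 'X^(\sum_(k < i.+1) k * l k)).
  rewrite big_split /= -rmorph_prod natr_prod prodfV; congr (_ * _).
  rewrite -prodrXr -scaler_prod; apply: eq_bigr => k _.
  by rewrite exprZn exprM.
rewrite fE coefCM coefZ coefXn eq_sym; case: eqP => _; last by rewrite !mulr0 scaler0.
rewrite linearZ /= mulr1 -scalerAl mul1r scalerA; congr (_ *: _).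
rewrite (big_morph (lext (evm g)) (@evM g) (ev1 g)) /=.
rewrite big_mkcond /=; apply: eq_bigr => k _.
case: k => [[|k] lk] /=; first by rewrite g0 expr1n.
by rewrite [LHS](evX g) (@ev_tgen g k.+1 g0).
Qed.

Lemma ev2_Delta_gen g1 g2 i : g1 0%N = 1 -> g2 0%N = 1 ->
  ev2 g1 g2 (Delta_gen K i) = star g1 g2 i.
Proof.
move=> h1 h2; rewrite /ev2 linear_sum; apply: eq_bigr => j _.
by rewrite [LHS]ev2_tensor ev_tgen // ev_fdb_right // -ltnS.
Qed.

Lemma ev2_Delta g1 g2 h : g1 0%N = 1 -> g2 0%N = 1 ->
  ev2 g1 g2 (Delta h) = ev (star g1 g2) h.
Proof.
move=> h1 h2; rewrite /ev2 linear_sum; apply: eq_bigr => m _.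
rewrite linearZ /=; congr (_ *: _).
rewrite [LHS](big_morph (ev2 g1 g2) (@ev2M g1 g2) (ev2_1 g1 g2)) /=.
by apply: eq_bigr => k _; rewrite ev2X ev2_Delta_gen.
Qed.

Lemma star_0 g1 g2 : g1 0%N = 1 -> g2 0%N = 1 -> star g1 g2 0 = 1.
Proof.
by move=> h1 h2; rewrite /star big_ord1 h1 mul1r expr1 coef_ser.
Qed.
End Eval.

Section CoproductMorphism.
Variable K : fieldType.

Lemma Delta_alg_morphism :
  [/\ forall c (g h : fdb K), Delta (c *: g + h) = c *: Delta g + Delta h,
      Delta (1 : fdb K) = 1,
      forall g h : fdb K, Delta (g * h) = Delta g * Delta h
    & forall i, (0 < i)%N -> Delta (tgen K i) = Delta_gen K i].
Proof.
split; first exact: (lext_is_linear (evm (Delta_gen K))).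
- exact: (ev1 (Delta_gen K)).
- exact: (evM (Delta_gen K)).
- case=> // i _; rewrite -[LHS]/(lext (evm (Delta_gen K)) _) /=.
  by rewrite lextU scale1r evmU.
Qed.
End CoproductMorphism.

Section Convolution.
Variable K : fieldType.
Hypothesis charK : [pchar K] =i pred0.
Notation C := {cmonom nat}.
Notation fun_ := (functional K).
Implicit Types a b c : fun_.

Lemma malgMU (M : monomType) (m n : M) :
  (<< m >> * << n >> : {malg K[M]}) = << mmul m n >>.
Proof. by rewrite malgM_def fgmulUU mul1r. Qed.

Lemma evm_incl (M : conomType) (g : nat -> {malg K[M]}) (i : C -> M) :
  i (@mone C) = @mone M -> (forall m n, i (mmul m n) = mmul (i m) (i n)) ->
  (forall k, << i (ucm k) >> = g k.+1) -> forall m, evm g m = << i m >>.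
Proof.
move=> i1 iM iU m; apply/esym.
apply: (@evm_unique K {malg K[M]} g (fun m => << i m >>)) => [|m' n'|k].
- by rewrite i1.
- by rewrite iM -malgMU.
- exact: iU.
Qed.

Lemma evm_tgen m : evm (tgen K) m = << m >>.
Proof. by rewrite (@evm_incl _ (tgen K) id). Qed.

Lemma ev_tgen_id (h : fdb K) : ev (tgen K) h = h.
Proof. by rewrite -[RHS]lext_id; apply: eq_lext; exact: evm_tgen. Qed.

Lemma tensor_funE a b z :
  tensor_fun a b z = lext (fun mn : C * C => a << mn.1 >> * b << mn.2 >> : K^o) z.
Proof. by []. Qed.

Lemma ev_U (S : comAlgType K) (g : nat -> S) m : ev g << m >> = evm g m.
Proof. by rewrite /ev lextU scale1r. Qed.


Lemma lext_mulr (M : choiceType) (S : lalgType K) (F : M -> S) z (e : S) :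
  lext F z * e = lext (fun m => F m * e) z.
Proof. by rewrite mulr_suml; apply: eq_bigr => m _; rewrite scalerAl. Qed.

Section Associativity.
Variables (M : conomType) (mk : C -> C -> C -> M) (pr1 pr2 pr3 : M -> C).
Hypothesis mk1 : mk (@mone C) (@mone C) (@mone C) = @mone M.
Hypothesis mkM : forall p q n p' q' n',
  mk (mmul p p') (mmul q q') (mmul n n') = mmul (mk p q n) (mk p' q' n').
Hypothesis pr1K : forall p q n, pr1 (mk p q n) = p.
Hypothesis pr2K : forall p q n, pr2 (mk p q n) = q.
Hypothesis pr3K : forall p q n, pr3 (mk p q n) = n.
Local Notation T3 := {malg K[M]}.

Let inc1 i : T3 := if i is k.+1 then << mk (ucm k) (@mone C) (@mone C) >> else 1.
Let inc2 i : T3 := if i is k.+1 then << mk (@mone C) (ucm k) (@mone C) >> else 1.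
Let inc3 i : T3 := if i is k.+1 then << mk (@mone C) (@mone C) (ucm k) >> else 1.

Lemma evm_inc p q n :
  evm inc1 p * evm inc2 q * evm inc3 n = << mk p q n >>.
Proof.
rewrite (@evm_incl M inc1 (fun m => mk m (@mone C) (@mone C))) //;
  last by move=> m' n'; rewrite -mkM !mul1m.
rewrite (@evm_incl M inc2 (fun m => mk (@mone C) m (@mone C))) //;
  last by move=> m' n'; rewrite -mkM !mul1m.
rewrite (@evm_incl M inc3 (fun m => mk (@mone C) (@mone C) m)) //;
  last by move=> m' n'; rewrite -mkM !mul1m.
by rewrite !malgMU -!mkM !mul1m !mulm1.
Qed.

Let F3 a b c : T3 -> K^o :=
  lext (fun x : M => a << pr1 x >> * b << pr2 x >> * c << pr3 x >> : K^o).

Lemma F3l a b c y n :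
  F3 a b c (ev2 inc1 inc2 y * evm inc3 n) = tensor_fun a b y * c << n >>.
Proof.
rewrite /ev2 lext_mulr /F3 lext_lin tensor_funE [RHS]lext_mulr.
by apply: eq_lext => -[p q] /=; rewrite evm_inc lextU scale1r pr1K pr2K pr3K.
Qed.

Lemma F3r a b c y n :
  F3 a b c (evm inc1 n * ev2 inc2 inc3 y) = a << n >> * tensor_fun b c y.
Proof.
rewrite mulrC [RHS]mulrC /ev2 lext_mulr /F3 lext_lin tensor_funE [RHS]lext_mulr.
by apply: eq_lext => -[p q] /=; rewrite mulrC [RHS]mulrC mulrA evm_inc lextU scale1r pr1K pr2K pr3K mulrA.
Qed.

Lemma convA_abs a b c : conv (conv a b) c =1 conv a (conv b c).
Proof.
move=> h; have i1 : inc1 0 = 1 by []; have i2 : inc2 0 = 1 by [].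
have i3 : inc3 0 = 1 by [].
have s12 := star_0 i1 i2; have s23 := star_0 i2 i3.
transitivity (F3 a b c (ev2 (star inc1 inc2) inc3 (Delta h))).
  rewrite {1}/conv tensor_funE /ev2 /F3 [RHS]lext_lin; apply: (@eq_lext _ _ K^o) => -[m n] /=.
  by rewrite -[evm (star _ _) _]ev_U -(ev2_Delta charK _ i1 i2) -/(F3 a b c _) F3l.
have e : ev (star (star inc1 inc2) inc3) h = ev (star inc1 (star inc2 inc3)) h.
  by apply: eq_lext; apply: eq_evm => k; exact: starA.
rewrite (ev2_Delta charK h s12 i3) e -(ev2_Delta charK h i1 s23).
rewrite {1}/conv tensor_funE /ev2 /F3 [LHS]lext_lin; apply: (@eq_lext _ _ K^o) => -[m n] /=.
by rewrite -[evm (star _ _) _]ev_U -(ev2_Delta charK _ i2 i3) -/(F3 a b c _) F3r.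
Qed.
End Associativity.

Lemma convA a b c : conv (conv a b) c =1 conv a (conv b c).
Proof.
exact: (@convA_abs (C * C * C)%type (fun p q n => (p, q, n))
  (fun x => x.1.1) (fun x => x.1.2) (fun x => x.2)).
Qed.

Lemma conv_lin a b k g h : conv a b (k *: g + h) = k * conv a b g + conv a b h.
Proof.
have e : Delta (k *: g + h) = k *: Delta g + Delta h.
  exact: (lext_is_linear (evm (Delta_gen K)) k g h).
rewrite /conv e.
exact: (lext_is_linear (fun mn : C * C => a << mn.1 >> * b << mn.2 >> : K^o) k).
Qed.

Lemma eq_conv a a' b b' : a =1 a' -> b =1 b' -> conv a b =1 conv a' b'.
Proof. by move=> ea eb h; apply: eq_bigr => m _; rewrite ea eb. Qed.

Definition is_lin (f : fun_) := forall k g h, f (k *: g + h) = k * f g + f h.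

Lemma counit_lin : is_lin (@counit K).
Proof. by move=> c g h; rewrite /counit mcoeffD mcoeffZ. Qed.

Lemma evm_gen0 (m : C) : evm (@gen0 (fdb K)) m = (m == @mone C)%:R.
Proof.
apply/esym; apply: (@evm_unique K (fdb K) (@gen0 _) (fun m => (m == @mone C)%:R)).
- by rewrite eqxx.
- by move=> m' n'; rewrite cmM_eq1 -natrM mulnb.
- by move=> k; rewrite cm1_eq1.
Qed.

Lemma counitU (m : C) : counit << m >> = (m == @mone C)%:R :> K.
Proof. by rewrite /counit mcoeffU1. Qed.

Lemma conv1f f : is_lin f -> conv (@counit K) f =1 f.
Proof.
move=> fl h; have g1 : @gen0 (fdb K) 0 = 1 by [].
have t0 : tgen K 0 = 1 by [].
have e : ev (star (@gen0 _) (tgen K)) h = h.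
  rewrite -[RHS]ev_tgen_id; apply: eq_lext; apply: eq_evm => k; exact: star0g.
rewrite -{2}e -(ev2_Delta charK h g1 t0) /conv tensor_funE /ev2.
rewrite [RHS](linfun_lext fl) [RHS]lext_lin; apply: (@eq_lext _ _ K^o) => -[m n] /=.
rewrite counitU evm_gen0 evm_tgen -(linfun_lext fl).
case: (m == _); rewrite ?mul1r // !mul0r.
by have := fl (-1) 0 0; rewrite scaler0 addr0 mulN1r addNr.
Qed.

Lemma convf1 f : is_lin f -> conv f (@counit K) =1 f.
Proof.
move=> fl h; have g1 : @gen0 (fdb K) 0 = 1 by [].
have t0 : tgen K 0 = 1 by [].
have e : ev (star (tgen K) (@gen0 _)) h = h.
  rewrite -[RHS]ev_tgen_id; apply: eq_lext; apply: eq_evm => k; exact: starg0.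
rewrite -{2}e -(ev2_Delta charK h t0 g1) /conv tensor_funE /ev2.
rewrite [RHS](linfun_lext fl) [RHS]lext_lin; apply: (@eq_lext _ _ K^o) => -[m n] /=.
rewrite counitU evm_gen0 evm_tgen -(linfun_lext fl).
case: (n == _); rewrite ?mulr1 // !mulr0.
by have := fl (-1) 0 0; rewrite scaler0 addr0 mulN1r addNr.
Qed.
End Convolution.

Section Grading.
Variable K : fieldType.
Notation C := {cmonom nat}.

Lemma mon_degEw (m : C) (d : {fset nat}) : (finsupp m `<=` d)%fset ->
  mon_deg m = (\sum_(k <- d) k.+1 * m k)%N.
Proof.
move=> le; rewrite /mon_deg (big_fset_incl _ le) // => k _ nk.
by rewrite (fsfun_dflt nk) muln0.
Qed.

Lemma mon_degM (m n : C) : mon_deg (mmul m n) = (mon_deg m + mon_deg n)%N.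
Proof.
rewrite {1}/mon_deg mdomD (mon_degEw (fsubsetUl (finsupp m) (finsupp n))).
rewrite (mon_degEw (fsubsetUr (finsupp m) (finsupp n))) -big_split /=.
by apply: eq_bigr => k _; rewrite cmM mulnDr.
Qed.

Lemma mon_deg1 : mon_deg (@mone C) = 0%N.
Proof. by rewrite /mon_deg mdom1 big_seq_fset0. Qed.

Lemma mon_degU k : mon_deg (ucm k) = k.+1.
Proof. by rewrite /mon_deg mdomU big_seq_fset1 cmUU muln1. Qed.

Section Hom.
Variables (M : conomType) (dg : M -> nat).
Hypothesis dg1 : dg (@mone M) = 0%N.
Hypothesis dgM : forall m n, dg (mmul m n) = (dg m + dg n)%N.

Definition homog (d : nat) (z : {malg K[M]}) :=
  forall m, z@_m != 0 -> dg m = d.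

Lemma homogZ d c z : homog d z -> homog d (c *: z).
Proof.
by move=> h m; rewrite mcoeffZ mulf_eq0 negb_or => /andP[_ /h].
Qed.

Lemma homog_sum d (I : Type) (r : seq I) (P : pred I) (F : I -> {malg K[M]}) :
  (forall i, P i -> homog d (F i)) -> homog d (\sum_(i <- r | P i) F i).
Proof.
move=> h; elim/big_ind: _ => // [m|x y hx hy m]; first by rewrite mcoeff0 eqxx.
rewrite mcoeffD; have [x0|/hx->//] := eqVneq x@_m 0.
by rewrite x0 add0r => /hy.
Qed.

Lemma homogU c m : homog (dg m) << c *g m >>.
Proof.
by move=> n; rewrite mcoeffU; case: (eqVneq m n) => [->//|_]; rewrite mulr0n eqxx.
Qed.

Lemma homog1 : homog 0 1.
Proof. by rewrite -[0%N]dg1; exact: homogU. Qed.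

Lemma homogM d e u v : homog d u -> homog e v -> homog (d + e) (u * v).
Proof.
move=> hu hv; rewrite malgME -[(\sum_(_ <- _) _)]/(\sum_(_ <- _) _).
rewrite big_seq; apply: homog_sum => m; rewrite -mcoeff_neq0 => /hu <-.
rewrite big_seq; apply: homog_sum => n; rewrite -mcoeff_neq0 => /hv <-.
by rewrite -dgM; exact: homogU.
Qed.

Lemma homogX d n u : homog d u -> homog (d * n) (u ^+ n).
Proof.
move=> h; elim: n => [|n IH]; first by rewrite muln0; exact: homog1.
by rewrite exprS mulnS; exact: homogM.
Qed.

Lemma homog_prod (I : Type) (r : seq I) (P : pred I) (D : I -> nat)
  (F : I -> {malg K[M]}) : (forall i, P i -> homog (D i) (F i)) ->
  homog (\sum_(i <- r | P i) D i) (\prod_(i <- r | P i) F i).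
Proof.
move=> h; elim/big_rec2: _ => [|i y1 y2 /h hi IH]; first exact: homog1.
exact: homogM.
Qed.
End Hom.

Lemma tgen_homog i : homog (@mon_deg) i (tgen K i).
Proof.
case: i => [|i]; first exact: (homog1 mon_deg1).
by rewrite /= -mon_degU; exact: homogU.
Qed.

Lemma fdb_right_homog i j : homog (@mon_deg) (i - j) (fdb_right K i j).
Proof.
apply: homog_sum => l /andP[_ /eqP <-]; apply: homogZ.
have -> : (\sum_(k < i.+1) k * l k = \sum_(k < i.+1 | (0 < k)%N) k * l k)%N.
  rewrite [RHS]big_mkcond; apply: eq_bigr => k _.
  by case: ltnP => //; rewrite leqn0 => /eqP ->.
apply: homog_prod => [||k _]; [exact: mon_deg1 | exact: mon_degM |].
by apply: (homogX mon_deg1 mon_degM); exact: tgen_homog.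
Qed.

Let dg2 (mn : C * C) := (mon_deg mn.1 + mon_deg mn.2)%N.

Lemma tensor_homog d e u v : homog (@mon_deg) d u -> homog (@mon_deg) e v ->
  homog (M := (C * C)%type) dg2 (d + e) (tensor u v).
Proof.
move=> hu hv; rewrite /tensor big_seq; apply: homog_sum => m.
rewrite -mcoeff_neq0 => /hu <-.
rewrite big_seq; apply: homog_sum => n; rewrite -mcoeff_neq0 => /hv <-.
exact: (@homogU (C * C)%type dg2 _ (m, n)).
Qed.

Lemma Delta_homog m : homog (M := (C * C)%type) dg2 (mon_deg m)
  (Delta (<< m >> : fdb K)).
Proof.
have d1 : dg2 (@mone (C * C)%type) = 0%N by rewrite /dg2 /= mon_deg1.
have dM (x y : C * C) : dg2 (mmul x y) = (dg2 x + dg2 y)%N.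
  by rewrite /dg2 /= !mon_degM addnACA.
have -> : Delta (<< m >> : fdb K) = evm (Delta_gen K) m.
  by rewrite -[LHS]/(lext (evm (Delta_gen K)) _) lextU scale1r.
apply: (homog_prod (M := (C * C)%type) d1 dM) => k _.
apply: (homogX (M := (C * C)%type) d1 dM).
apply: homog_sum => j _.
rewrite -[X in homog _ X _](@subnKC j k.+1) -1?ltnS //.
by apply: tensor_homog; [exact: tgen_homog | exact: fdb_right_homog].
Qed.

Definition fun_homog (d : nat) (f : functional K) :=
  forall m, f << m >> != 0 -> mon_deg m = d.

Lemma conv_homog d e f g : fun_homog d f -> fun_homog e g ->
  fun_homog (d + e) (conv f g).
Proof.
move=> hf hg m nz; apply/eqP; apply: contraNT nz => nde; apply/eqP.
rewrite /conv /tensor_fun big_seq big1 // => -[p q].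
rewrite -mcoeff_neq0 => /Delta_homog; rewrite /dg2 /= => e1.
have [->|/hf e2] := eqVneq (f << p >>) 0; first by rewrite mul0r mulr0.
have [->|/hg e3] := eqVneq (g << q >>) 0; first by rewrite !mulr0.
by move: nde; rewrite -e1 e2 e3 eqxx.
Qed.
End Grading.

Section Rho.
Variable K : fieldType.
Hypothesis charK : [pchar K] =i pred0.
Notation W := {fmonom nat}.

Definition rho_word (s : seq nat) : functional K :=
  foldr (fun k f => conv (t' k.+1) f) (@counit K) s.

Definition rho_std (w : freeAlg K) : functional K :=
  fun h => lext (fun s : W => rho_word s h : K^o) w.

Lemma t'_lin i : is_lin (@t' K i).
Proof. by move=> k g h; rewrite /t' mcoeffD mcoeffZ. Qed.

Lemma rho_word_lin s : is_lin (rho_word s).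
Proof. by case: s => [|k s] /=; [exact: counit_lin | exact: conv_lin]. Qed.

Lemma rho_word_cat s1 s2 :
  rho_word (s1 ++ s2) =1 conv (rho_word s1) (rho_word s2).
Proof.
elim: s1 => [|k s IH] h; first by rewrite (conv1f charK) //; exact: rho_word_lin.
by rewrite /= (convA charK); apply: eq_conv => // ?; exact: IH.
Qed.

Lemma rho_word_homog (s : seq nat) :
  fun_homog (\sum_(k <- s) k.+1) (rho_word s).
Proof.
elim: s => [|k s IH] /=.
  rewrite big_nil => m; rewrite counitU; case: (m =P _) => [->|_]; last by rewrite eqxx.
  by rewrite mon_deg1.
rewrite big_cons; apply: conv_homog => // m.
by rewrite /t' mcoeffU1 /=; case: (m =P _) => [->|_]; rewrite ?mon_degU // eqxx.
Qed.

Lemma rho_std_lin w : is_lin (rho_std w).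
Proof.
move=> c g h; rewrite /rho_std /lext mulr_sumr -big_split; apply: eq_bigr => s _.
by rewrite rho_word_lin /GRing.scale /= mulrDr mulrCA.
Qed.

Lemma rho_stdU s : rho_std << s >> =1 rho_word s.
Proof. by move=> h; rewrite /rho_std lextU scale1r. Qed.

Lemma rho_std_is_rho : is_rho rho_std.
Proof.
split.
- move=> w; split; first exact: rho_std_lin.
  exists (\max_(s <- msupp w) \sum_(k <- (s : W)) k.+1)%N => m lt.
  rewrite /rho_std /lext big_seq big1 // => s sw.
  have [->|/rho_word_homog e] := eqVneq (rho_word s << m >>) 0; first by rewrite scaler0.
  move: lt; rewrite e ltnNge => /negP[].
  exact: (@leq_bigmax_seq W _ predT (fun s : W => \sum_(k <- s) k.+1)%N).
- by move=> c u v h; exact: (lext_is_linear (fun s : W => rho_word s h : K^o)).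
- move=> h; rewrite -[1]/(<< @mone W >>) rho_stdU.
  by rewrite fm1.
- move=> u v h.
  transitivity (\sum_(s <- msupp u) \sum_(t <- msupp v)
      \sum_(mn <- msupp (Delta h)) (Delta h)@_mn *
        ((u@_s * rho_word s << mn.1 >>) * (v@_t * rho_word t << mn.2 >>))).
    rewrite malgME /rho_std linear_sum; apply: eq_bigr => s _.
    rewrite linear_sum; apply: eq_bigr => t _ /=; rewrite lextU fmM rho_word_cat.
    rewrite /conv /tensor_fun -[_ *: _]/(_ * _) mulr_sumr; apply: eq_bigr => mn _.
    by rewrite mulrCA [in RHS]mulrACA.
  under eq_bigr do rewrite exchange_big /=.
  rewrite exchange_big /=; apply: eq_bigr => mn _.
  under eq_bigr do rewrite -mulr_sumr -mulr_sumr.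
  by rewrite -mulr_sumr -mulr_suml.
- case=> // i _ h; rewrite /Xgen /= rho_stdU fmU /=.
  by rewrite (convf1 charK) //; exact: t'_lin.
Qed.

Lemma rho_exists : exists rho : freeAlg K -> functional K, is_rho rho.
Proof. by exists rho_std; exact: rho_std_is_rho. Qed.

Lemma rho_unique (rho : freeAlg K -> functional K) :
  is_rho rho -> forall w, rho w =1 rho_std w.
Proof.
case=> dual lin r1 rM rX.
have rU (s : W) : rho << s >> =1 rho_word s.
  case: s => s; rewrite -fmE; elim: s => [|k s IH] h.
    by rewrite -[LHS]/(rho 1 h) r1 fmE.
  have -> : << fmonom_of_seq fmonom_key (k :: s) >> =
      Xgen K k.+1 * << fmonom_of_seq fmonom_key s >>.
    rewrite /Xgen malgMU; congr << _ >>; apply/eqP; rewrite fmP fmM fmU.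
    by rewrite !fmE.
  rewrite rM !fmE /=; apply: eq_conv => [|h']; first exact: rX.
  by rewrite -fmE IH fmE.
move=> w h; rewrite /rho_std.
rewrite [LHS](@linfun_lext K W (fun w => rho w h)) => [|c u v]; last exact: lin.
by apply: (@eq_lext _ _ K^o) => s; exact: rU.
Qed.

Fixpoint words_upto (N n : nat) : seq (seq nat) :=
  if n is n'.+1 then
    [::] :: [seq k :: s | k <- iota 0 N, s <- words_upto N n']
  else [:: [::]].

Lemma words_uptoP N n (s : seq nat) :
  (size s <= n)%N -> all (fun k => (k < N)%N) s -> s \in words_upto N n.
Proof.
elim: n s => [|n IH] [|k s] //= sn /andP[kN sN]; rewrite inE /=.
apply/allpairsP; exists (k, s); split=> //=; first by rewrite mem_iota.
exact: IH.
Qed.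

Lemma words_upto_deg N (s : seq nat) :
  (\sum_(k <- s) k.+1 <= N)%N -> s \in words_upto N N.
Proof.
move=> sN; apply: words_uptoP.
  apply: leq_trans sN; elim: s => // k s IH; rewrite big_cons /= addSn ltnS.
  exact: leq_trans IH (leq_addl _ _).
apply/allP => k ks; apply: leq_trans sN.
by rewrite (big_rem k ks) /= leq_addr.
Qed.

Lemma transpose_exists (rho : freeAlg K -> functional K) : is_rho rho ->
  exists rhoT : fdb K -> words K, is_transpose rho rhoT.
Proof.
move=> rhoP; have rE := rho_unique rhoP.
pose N (h : fdb K) := (\max_(m <- msupp h) mon_deg m)%N.
pose D (h : fdb K) : {fset W} :=
  [fset fmonom_of_seq fmonom_key s | s in words_upto (N h) (N h)]%fset.
exists (fun h => [malg s in D h => rho_word s h]) => w h.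
rewrite rE /rho_std /pairing /lext; apply: eq_bigr => s _; congr (_ * _).
rewrite mcoeffE; case: ifP => // /negP nD; apply/esym.
apply/eqP; apply: contra_notT nD => nz.
have [m mh nzm] : exists2 m, m \in msupp h & rho_word s << m >> != 0.
  apply/hasP; apply: contraNT nz => /hasPn hz.
  rewrite (linfun_lext (@rho_word_lin s)) /lext big_seq big1 // => m /hz.
  by rewrite negbK => /eqP ->; rewrite scaler0.
apply/imfsetP; exists (s : seq nat); last by case: (s) => s'; rewrite fmE.
apply: words_upto_deg; rewrite -(rho_word_homog nzm).
exact: (@leq_bigmax_seq {cmonom nat} _ predT (@mon_deg)).
Qed.
End Rho.

(* Main.v *)
Require Import Defs.
From mathcomp Require Import all_boot all_order all_algebra finmap.
From mathcomp.multinomials Require Import monalg.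
Import GRing.Theory.
Local Open Scope ring_scope.

(** Since [t'] vanishes on products of augmentation-ideal elements, it is a
    derivation over the counit; applied to the [j+1]-st power of the generic
    series it kills all but the linear part, whence
    [t'_m (fdb_right i j) = (j + 1) * [j + m = i]].  Splitting off the last
    letter of a word then gives
    [rho (w X_m) (t_i) = (i - m + 1) * rho w (t_(i-m))],
    which is the recursion satisfied by the coefficients [p_coef]. *)

(** The first part occurs in every partial sum, so it can be absorbed into the argument [t]. *)
Lemma p_coef_cons (K : fieldType) a (c : seq nat) (t : K) :
  p_coef (a :: c) t = (t - a%:R + 1) * p_coef c (t - a%:R).
Proof.
rewrite /p_coef /= big_ltn // big_add1 /= take0 big_seq1; congr (_ * _).
by apply: eq_bigr => j _; rewrite big_cons natrD opprD addrA.
Qed.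

(** Degrees add, so one factor of a degree-one product is trivial. The identity lives in [nat] so
    that [t'M] can cast it into [K]. *)
Lemma mmul_eq_ucm (k : nat) (m n : {cmonom nat}) :
  (mmul m n == ucm k : nat) =
  ((m == mone) * (n == ucm k) + (m == ucm k) * (n == mone))%N.
Proof.
have U1 : (mone == ucm k) = false by rewrite eq_sym; exact: cm1_eq1.
have [->|m1] := eqVneq m mone; first by rewrite mul1m U1 mul1n addn0.
have [->|n1] := eqVneq n mone; first by rewrite mulm1 muln1.
rewrite mul0n muln0; case: eqP => // /(congr1 (@mdeg _)).
rewrite mdegM mdegU => e; move: m1 n1; rewrite -!mdeg_eq0; move: e.
by case: (mdeg m) => // -[|a]; case: (mdeg n).
Qed.

Section Derivation.
Variable K : fieldType.
Implicit Types u v : fdb K.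

Lemma t'M m u v :
  t' m (u * v) = counit u * t' m v + t' m u * counit v.
Proof.
have E (k : {cmonom nat}) (w : fdb K) :
    w@_k = \sum_(n <- msupp w) w@_n * (n == k)%:R.
  rewrite {1}(monalgE w) linear_sum; apply: eq_bigr => n _ /=.
  by rewrite mcoeffU mulr_natr.
(* Both Leibniz terms become double sums over monomials, so that [mmul_eq_ucm] applies termwise. *)
have E2 (k l : {cmonom nat}) : u@_k * v@_l = \sum_(m1 <- msupp u)
    \sum_(m2 <- msupp v) u@_m1 * v@_m2 * ((m1 == k) * (m2 == l))%:R.
  rewrite (E k) (E l) mulr_suml; apply: eq_bigr => m1 _.
  by rewrite mulr_sumr; apply: eq_bigr => m2 _; rewrite natrM mulrACA.
rewrite /t' /counit !E2 -big_split /= malgME linear_sum.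
apply: eq_bigr => m1 _ /=; rewrite linear_sum -big_split /=.
apply: eq_bigr => m2 _; rewrite [LHS]mcoeffU.
by rewrite -mulrDr -natrD -mmul_eq_ucm mulr_natr.
Qed.

Lemma counit1 : counit (1 : fdb K) = 1.
Proof. exact: (rmorph1 (mcoeff (@mone {cmonom nat}))). Qed.

Lemma map_counitX (p : {poly fdb K}) n :
  map_poly (@counit K) (p ^+ n) = map_poly (@counit K) p ^+ n.
Proof. exact: (rmorphXn (map_poly (mcoeff (@mone {cmonom nat})))). Qed.

(** The power rule for the derivation of [t'M], acting on coefficients. *)
Lemma map_t'X m (p : {poly fdb K}) n :
  map_poly (t' m) (p ^+ n.+1) =
  n.+1%:R *: (map_poly (@counit K) p ^+ n * map_poly (t' m) p).
Proof.
have c0 : @counit K 0 = 0 by rewrite /counit mcoeff0.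
have d0 : @t' K m 0 = 0 by rewrite /t' mcoeff0.
elim: n => [|n IH]; first by rewrite scale1r mul1r expr1.
have M (q : {poly fdb K}) : map_poly (t' m) (p * q) =
    map_poly (@counit K) p * map_poly (t' m) q
    + map_poly (t' m) p * map_poly (@counit K) q.
  apply/polyP => i; rewrite coef_map_id0 // coefD !coefM -big_split /=.
  rewrite /t' linear_sum; apply: eq_bigr => j _.
  by rewrite [LHS]t'M !coef_map_id0.
rewrite exprS M IH map_counitX -scalerAr mulrA -exprS.
by rewrite [X in _ + X]mulrC -[n.+2%:R]natr1 scalerDl scale1r.
Qed.

Lemma counit_tgen i : counit (tgen K i) = (i == 0%N)%:R.
Proof. by case: i => [|i]; [exact: counit1 | rewrite [LHS]counitU cm1_eq1]. Qed.

Lemma t'_tgen m i : (0 < m)%N -> t' m (tgen K i) = (i == m)%:R.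
Proof.
case: m => // m _; case: i => [|i]; rewrite /t' /=.
  by rewrite mcoeff1 cm1_eq1.
rewrite mcoeffU1 eqSS; congr (_%:R); congr nat_of_bool.
apply/eqP/eqP => [|->//] /(congr1 (fun w : {cmonom nat} => w m)).
by rewrite !cmU eqxx; case: eqP.
Qed.

Hypothesis charK : [pchar K] =i pred0.

(** [fdb_right K i j] is the coefficient at [i.+1] of [ser i (tgen K) ^+ j.+1], so [map_t'X]
    applies. *)
Lemma t'_fdb_right m i j : (0 < m)%N -> (j <= i)%N ->
  t' m (fdb_right K i j) = (j.+1 * (j + m == i))%N%:R.
Proof.
move=> m0 ji; have t0 : tgen K 0 = 1 by [].
have c0 : @counit K 0 = 0 by rewrite /counit mcoeff0.
have d0 : @t' K m 0 = 0 by rewrite /t' mcoeff0.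
rewrite -[fdb_right K i j]ev_tgen_id (ev_fdb_right charK t0 ji).
rewrite -coef_map_id0 // map_t'X coefZ natrM; congr (_ * _).
(* The counit kills t_k for k > 0, leaving only the leading term t_0 X of the series. *)
have -> : map_poly (@counit K) (ser i (tgen K)) = 'X.
  apply/polyP => -[|k]; rewrite coef_map_id0 // coefX.
    by rewrite coef_ser0.
  case: (leqP k i) => ki; first by rewrite coef_ser // counit_tgen.
  rewrite /ser coef_sum big1 ?c0; last first.
    move=> l _; rewrite coefZ coefXn eqSS gtn_eqF ?mulr0 //.
    by apply: leq_ltn_trans ki; rewrite -ltnS.
  by case: k ki.
(* Cancelling ['X^j] leaves the coefficient at [(i - j).+1], which is [t' m] of t_(i-j). *)
rewrite coefXnM ltnNge leqW //= subSn // coef_map_id0 // coef_ser ?leq_subr //.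
by rewrite t'_tgen // -(eqn_add2l j) subnKC // eq_sym.
Qed.

Lemma tensor_fun_tensor (a b : functional K) u v : is_lin a -> is_lin b ->
  tensor_fun a b (tensor u v) = a u * b v.
Proof.
move=> la lb; rewrite tensor_funE /tensor linear_sum.
rewrite (linfun_lext la) (linfun_lext lb) mulr_suml; apply: eq_bigr => m _.
rewrite linear_sum mulr_sumr; apply: eq_bigr => n _ /=.
by rewrite lextU /= /GRing.scale /= mulrACA.
Qed.

(** The letter [k] stands for X_(k+1), so the factor i - m + 1 with m = k + 1 reads [i - k]. *)
Lemma rho_word_rcons s k i :
  rho_word (rcons s k) (tgen K i) =
  if (k < i)%N then (i - k)%:R * rho_word s (tgen K (i - k.+1)) else 0.
Proof.
rewrite -cats1 (rho_word_cat charK).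
transitivity (conv (rho_word s) (t' k.+1) (tgen K i)).
  by apply: eq_conv => // h; apply: (convf1 charK); exact: t'_lin.
have [_ D1 _ Dg] := Delta_alg_morphism K.
case: i => [|i].
  rewrite /conv [tgen K 0]/(1) D1 tensor_funE lextU.
  by rewrite [X in _ * X](@t'_tgen k.+1 0) // mulr0 scaler0.
rewrite /conv Dg // tensor_funE /Delta_gen linear_sum /=.
rewrite (eq_bigr (fun j : 'I_i.+2 => rho_word s (tgen K j) *
    (j.+1 * (j + k.+1 == i.+1))%N%:R)); last first.
  move=> j _; rewrite -tensor_funE tensor_fun_tensor;
    [|exact: rho_word_lin|exact: t'_lin].
  by have ji : (j <= i.+1)%N := ltn_ord j; rewrite t'_fdb_right.
case: ifP => ki.
  (* The index is now [i.+1]: only [j = i - k] survives, with weight [j.+1], equal to [i.+1 - k]. *)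
  have lt : (i - k < i.+2)%N by rewrite ltnS leqW // leq_subr.
  rewrite (bigD1 (Ordinal lt)) //= addnS subnK // eqxx muln1 big1 ?addr0.
    by rewrite mulrC subSn.
  move=> j /negP nj; case: eqP => [e|_]; last by rewrite muln0 mulr0.
  by case: nj; apply/eqP/val_inj/(@addIn k.+1); rewrite /= e addnS subnK.
rewrite big1 // => j _; case: eqP => [e|_]; last by rewrite muln0 mulr0.
by rewrite -e leq_addl in ki.
Qed.

(** Removing the last letter of [s] removes the first part of the reversed composition, which is
    what [p_coef_cons] peels off. *)
Lemma rho_word_tgen (s : seq nat) i :
  rho_word s (tgen K i) =
  if (\sum_(k <- s) k.+1 == i)%N then p_coef (rev (map succn s)) i%:R else 0.
Proof.
elim/last_ind: s i => [|s k IH] i.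
  rewrite big_nil /p_coef big_geq // [LHS]counit_tgen eq_sym.
  by case: eqP.
rewrite rho_word_rcons -cats1 big_cat big_seq1 map_cat rev_cat /=.
rewrite /rev /= -/(rev _) p_coef_cons IH.
(* If [i <= k], the part [k.+1] alone exceeds [i] and both sides vanish. *)
case: ltnP => ki; last first.
  by rewrite gtn_eqF // addnS ltnS (leq_trans ki) // leq_addl.
rewrite -(eqn_add2r k.+1) subnK //; case: eqP => // _; last by rewrite mulr0.
by rewrite -natrB // natr1 subnSK.
Qed.
End Derivation.

Section Words.
Variable K : fieldType.

Lemma prod_alpha (c : seq nat) :
  \prod_(a <- c) alpha K a = << fmonom_of_seq fmonom_key (map predn c) >>.
Proof.
elim: c => [|a c IH]; first by rewrite big_nil.
rewrite big_cons IH /alpha malgMU; congr << _ >>; apply/eqP.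
by rewrite fmP fmM fmU !fmE.
Qed.

(** Since [alpha] stores the predecessor of its index, [alpha K 0] and [alpha K 1] coincide;
    positivity makes the word determine the composition. *)
Lemma coef_prod_alpha (c : seq nat) (s : {fmonom nat}) :
  all (fun a => 0 < a)%N c ->
  (\prod_(a <- rev c) alpha K a)@_s = (c == rev (map succn s))%:R.
Proof.
move=> c0; rewrite prod_alpha mcoeffU1 fmP fmE /=; congr (_%:R).
rewrite -[c == _](inj_eq (can_inj revK)) revK.
rewrite -[map predn _ == _](inj_eq (inj_map succn_inj)).
by rewrite -map_comp map_id_in // => a; rewrite mem_rev => /(allP c0) /prednK.
Qed.

(** A composition of [i] has at most [i] parts, each at most [i], so it is met exactly once; [0 < i]
    excludes the empty one. *)
Lemma sum_compositions (F : seq nat -> K) i (c0 : seq nat) : (0 < i)%N ->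
  \sum_(1 <= k < i.+1)
    \sum_(c : k.-tuple 'I_i.+1 | is_composition i (map val c))
      F (map val c) * (map val c == c0)%:R =
  if is_composition i c0 then F c0 else 0.
Proof.
move=> i0; case: ifPn => [/andP[pos0 /eqP sum0]|nc0]; last first.
  rewrite big1 // => k _; rewrite big1 // => c cc.
  by case: eqP => [e|_]; rewrite ?mulr0 //; rewrite e (negbTE nc0) in cc.
have szi : (size c0 <= i)%N.
  rewrite -sum0; elim: (c0) pos0 => //= a c IH /andP[a0 /IH le].
  by rewrite big_cons -add1n leq_add.
have sz0 : (0 < size c0)%N.
  by case: (c0) sum0 => //; rewrite big_nil => e; rewrite -e in i0.
rewrite (bigD1_seq (size c0)) ?iota_uniq ?mem_index_iota ?sz0 //=.
rewrite [X in _ + X]big1 ?addr0 => [|k nk]; last first.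
  rewrite big1 // => c _; case: eqP => [e|_]; last by rewrite mulr0.
  by case/eqP: nk; rewrite -e size_map size_tuple.
(* Each part is at most the total [i], so [inord] loses nothing. *)
pose t := map_tuple (@inord i) (in_tuple c0).
have tE : map val t = c0.
  rewrite /= -map_comp map_id_in // => a ac0; rewrite /= inordK //.
  by rewrite ltnS -sum0 (big_rem a ac0) leq_addr.
rewrite (bigD1 t) /=; last by rewrite tE /is_composition pos0 sum0 eqxx.
rewrite tE eqxx mulr1 big1 ?addr0 // => c /andP[_ nc].
case: eqP => [e|_]; last by rewrite mulr0.
by case/eqP: nc; apply/val_inj/(inj_map val_inj)/(etrans e (esym tE)).
Qed.
End Words.

Theorem theorem5p1 (K : fieldType) (charK : [pchar K] =i pred0)
  (rho : freeAlg K -> functional K) (rhoP : is_rho rho)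
  (rhoT : fdb K -> words K) (rhoTP : is_transpose rho rhoT)
  (i : nat) (i_gt0 : (0 < i)%N) :
  rhoT (tgen K i) = displacement (alpha K) i.
Proof.
apply/malgP => s.
have pE (w : freeAlg K) x : pairing w x = lext (fun s => x@_s : K^o) w by [].
(* Pairing with the monomial [<< s >>] reads off the coefficient of the word [s]. *)
have -> : (rhoT (tgen K i))@_s = rho << s >> (tgen K i).
  by rewrite -rhoTP pE lextU scale1r.
rewrite (rho_unique rhoP) rho_stdU (rho_word_tgen K charK).
set c0 := rev (map succn s).
transitivity (\sum_(1 <= k < i.+1)
    \sum_(c : k.-tuple 'I_i.+1 | is_composition i (map val c))
      p_coef (map val c) i%:R * (map val c == c0)%:R : K); last first.
  rewrite /displacement linear_sum; apply: eq_bigr => k _.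
  rewrite [RHS]linear_sum; apply: eq_bigr => c /andP[pos _].
  by rewrite [RHS]mcoeffZ coef_prod_alpha.
rewrite (sum_compositions K (fun c => p_coef c i%:R)) //.
(* The parts of [c0] are successors, hence positive, so only the condition on the sum remains. *)
congr (if _ then _ else _); rewrite /is_composition all_rev all_map.
rewrite (eq_all (a2 := predT)) // all_predT /=.
by rewrite (perm_big _ (permEl (perm_rev _))) big_map.
Qed.
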